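(* Let $p$ be a natural number greater than $4$. Then $p$ is prime if and only if $$(p-4)! \equiv (-1)^{\left[\frac{p}{3}\right]+1} \cdot \left[\frac{p+1}{6}\right] \pmod{p}.$$
   Context: For a real number $x$, $[x]$ denotes the integer part of $x$, i.e. the largest integer less than or equal to $x$. *)

(* Defs.v *)
From mathcomp Require Export all_boot all_order all_algebra.
From mathcomp Require Export reals.

Set Implicit Arguments.
Unset Strict Implicit.
Unset Printing Implicit Defensive.

(* Main.v *)
Require Import Defs.
From mathcomp Require Import archimedean zify ring.

Set Implicit Arguments.
Unset Strict Implicit.
Unset Printing Implicit Defensive.

Import Order.TTheory GRing.Theory Num.Theory.
Local Open Scope ring_scope.

(** By Wilson, [(p-1)! = (p-1)(p-2)(p-3) (p-4)! = -6 (p-4)!] modulo [p], so for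
    [p] prime the congruence can be tested after multiplication by [6], where it
    follows from [p = 6k+1] or [p = 6k+5]. Conversely, a composite [p > 10]
    divides [(p-4)!], whereas [0 < [(p+1)/6] < p]; the values [p <= 10] are
    checked by computation. *)

Lemma floor_divn (R : archiNumFieldType) (m d : nat) :
  (0 < d)%N -> Num.floor (m%:R / d%:R : R) = (m %/ d)%N.
Proof.
move=> d_gt0; have d_gt0R : 0 < d%:R :> R by rewrite ltr0n.
apply: floor_def; rewrite -PoszD -!pmulrn addn1.
rewrite ler_pdivlMr // ltr_pdivrMr // -!natrM ler_nat ltr_nat.
by rewrite leq_divM ltn_ceil.
Qed.

(** [(a + b)!] is a binomial coefficient times [a! * b!]; this argument also covers [a = b]. *)
Lemma dvdn_mul_fact (a b : nat) : (0 < a)%N -> (0 < b)%N ->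
  (a * b %| (a + b)`!)%N.
Proof.
move=> a_gt0 b_gt0; rewrite -(bin_fact (leq_addr b a)) addKn.
by rewrite dvdn_mull // dvdn_mul // dvdn_fact ?leqnn ?andbT.
Qed.

Lemma dvdn_fact_sub4 (n : nat) : ~~ prime n -> (10 < n)%N -> (n %| (n - 4)`!)%N.
Proof.
case/primePn => [|[a /andP[a_gt1 a_ltn] /dvdnP[b n_ab]]] n_gt10; first by lia.
have b_gt1 : (1 < b)%N by nia.
rewrite {1}n_ab; apply: dvdn_trans (dvdn_mul_fact _ _) _; [lia | lia |].
(* As [n = b * a], this amounts to [(a - 1) * (b - 1) >= 5], which fails for [10 = 2 * 5] but holds
   for every larger composite. *)
have ab_le : (b + a <= n - 4)%N by nia.
by rewrite -(bin_fact ab_le) mulnCA dvdn_mulr.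
Qed.

Lemma prime_dvd_fact_sub4 (p : nat) : prime p -> (4 < p)%N ->
  (p %| 6 * ((p - 4)`!)%:Z - 1)%Z.
Proof.
move=> p_pr p_gt4.
have := p_pr; rewrite Wilson ?prime_gt1 //.
have -> : p = (p - 4).+4 by lia.
move: (p - 4)%N => n; rewrite !subSS subn0 /= !factS => /dvdnP[c Ec].
have {}Ec : (n%:Z + 3) * (n%:Z + 2) * (n%:Z + 1) * n`!%:Z + 1 = c%:Z * (n%:Z + 4).
  by lia.
(* Writing [p] for [n + 4], the witness comes from [(p - 1)(p - 2)(p - 3) = p * (p ^ 2 - 6 * p + 11)
   - 6], with [c] the quotient in Wilson's theorem. *)
apply/dvdzP; exists (((n%:Z + 4) ^+ 2 - 6 * (n%:Z + 4) + 11) * n`!%:Z - c%:Z).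
have -> : n.+4%:Z = n%:Z + 4 by lia.
by rewrite mulrBl -Ec; ring.
Qed.

Lemma prime_mod6 (p : nat) : prime p -> (4 < p)%N ->
  (p %% 6 = 1)%N \/ (p %% 6 = 5)%N.
Proof.
move=> p_pr p_gt4.
have coprime_p q : prime q -> (q < 4)%N -> (p %% q != 0)%N.
  move=> q_pr q_lt4; apply/negP => q_dvd_p.
  by have := dvdn_prime2 q_pr p_pr; rewrite /dvdn q_dvd_p => /esym/eqP; lia.
by have := coprime_p 2 isT isT; have := coprime_p 3 isT isT; lia.
Qed.

Lemma prime_fact_sub4P (p : nat) : (4 < p)%N ->
  prime p =
  (((p - 4)`!)%:Z == (-1) ^+ (p %/ 3).+1 * (p.+1 %/ 6)%:Z %[mod p])%Z.
Proof.
move=> p_gt4; apply/idP/idP => [p_pr | ].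
  have p_coprime6 : coprimez p 6.
    rewrite coprimezE prime_coprime // (@Euclid_dvdM 2 3) //.
    by rewrite !gtnNdvd //; lia.
  rewrite eqz_mod_dvd -(Gauss_dvdzr _ p_coprime6).
  set k := (p.+1 %/ 6)%:Z; set s : int := (-1) ^+ _.
  have -> : 6 * (((p - 4)`!)%:Z - s * k) =
    (6 * ((p - 4)`!)%:Z - 1) - (6 * (s * k) - 1) by ring.
  rewrite rpredB ?prime_dvd_fact_sub4 //.
  (* Either [p = 6k + 1], the exponent is [2k + 1] and [6 * (s * k) - 1 = - p], or [p = 6k - 1], the
     exponent is [2k] and [6 * (s * k) - 1 = p]. *)
  have [p_mod | p_mod] := prime_mod6 p_pr p_gt4.
    have -> : s = -1 by rewrite /s -signr_odd (_ : odd _ = true) //; lia.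
    by apply/dvdzP; exists (-1); rewrite /k; lia.
  have -> : s = 1 by rewrite /s -signr_odd (_ : odd _ = false) //; lia.
  by apply/dvdzP; exists 1; rewrite /k; lia.
apply: contraLR => p_npr; have [p_gt10 | p_le10] := ltnP 10 p.
  rewrite eqz_mod_dvd rpredBl; last by rewrite dvdzE /= dvdn_fact_sub4.
  by rewrite dvdzE abszMsign /= gtnNdvd //; lia.
by move: p p_gt4 p_npr p_le10; do 11?[case=> //].
Qed.

Theorem theorem2 (R : realType) (p : nat) (p_gt4 : (4 < p)%N) :
  prime p <->
  (((p - 4)`!)%N%:Z =
     (-1 : int) ^ (Num.floor (p%:R / 3%:R : R) + 1)
       * Num.floor ((p%:R + 1) / 6%:R : R) %[mod p%:Z])%Z.
Proof.
rewrite natr1 !floor_divn // -PoszD addn1 prime_fact_sub4P //.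
by split=> /eqP.
Qed.
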